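(* Let $C>0$ be a constant such that for every positive integer $n$, if $G$ is a string graph with $n$ vertices and at most $Cn^{2}$ edges, then the complement of $G$ contains a bi-clique of size at least $\frac{n}{4}$. For every $\epsilon>0$ there exists $\delta>0$ such that the following holds. Let $G$ be a graph with $n$ vertices and at most $(\frac{1}{4}-\epsilon)\frac{n^{2}}{2}$ edges such that $G$ is $(4\delta,C)$-dense and $\delta$-full. Then $G$ contains a weak-subdivision of $K_{5}$.
   Context: A string graph is the intersection graph of a finite family of curves in the plane (curves are images of continuous maps $[0,1]\to\mathbb{R}^2$, adjacency = nonempty intersection). A bi-clique in a graph is a pair of disjoint vertex sets $(A,B)$ with $|A|=|B|$ and $ab$ an edge for all $a\in A,b\in B$; its size is $|A|$. For a graph $G$ with $n$ vertices and $0<\delta<\frac12$, $G$ is $\delta$-full if for every $A,B\subset V(G)$ with $|A|,|B|\geq\delta n$ there is an edge between $A$ and $B$. The density of a graph $G$ is $d(G)=|E(G)|/|V(G)|^{2}$. $G$ is $(\alpha,\beta)$-dense if every induced subgraph of $G$ with at least $\alpha n$ vertices has density at least $\beta$. A subdivision of a graph $H$ is obtained by replacing each edge $xy$ by a path from $x$ to $y$ with $k\ge1$ new internal vertices ($k$ may depend on the edge); vertices of $H$ are branch-vertices, new ones side-vertices. A weak-subdivision of $H$ is a graph $H''$ obtained from some subdivision $H'$ of $H$ by adding edges, each joining two side-vertices lying on the subdivisions of two distinct edges of $H$ that share an endpoint.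
   Formalization: The property of C is assumed only for n ≥ 2, since for n = 1 no C satisfies it (a one-vertex graph has no bi-clique of size at least 1/4); the weak-subdivision is found as an induced subgraph and δ < 1/2. *)

(* Defs.v *)
From HB Require Import structures.
From mathcomp Require Import all_boot all_order all_algebra.
From mathcomp Require Import all_classical all_reals all_analysis.

Set Implicit Arguments.
Unset Strict Implicit.
Unset Printing Implicit Defensive.

Import Order.TTheory GRing.Theory Num.Theory.
Import numFieldNormedType.Exports.

Local Open Scope classical_set_scope.
Local Open Scope ring_scope.

Record sgraph := SGraph {
  vertex :> finType;
  adj : rel vertex;
  adj_sym : symmetric adj;
  adj_irr : irreflexive adj
}.
Arguments SGraph : clear implicits.

Definition graph_order (G : sgraph) : nat := #|vertex G|.

Definition edges (G : sgraph) : {set {set G}} :=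
  [set S : {set G} | [exists x : G, exists y : G,
                        adj x y && (S == [set x; y]%SET)]]%SET.

Definition graph_density (R : realType) (G : sgraph) : R :=
  #|edges G|%:R / (graph_order G)%:R ^+ 2.

Section Complement.
Variable G : sgraph.
Definition compl_adj : rel G := fun x y => (x != y) && ~~ adj x y.
Lemma compl_adj_sym : symmetric compl_adj.
Proof. by move=> x y; rewrite /compl_adj eq_sym adj_sym. Qed.
Lemma compl_adj_irr : irreflexive compl_adj.
Proof. by move=> x; rewrite /compl_adj eqxx. Qed.
Definition complement : sgraph :=
  SGraph (vertex G) compl_adj compl_adj_sym compl_adj_irr.
End Complement.

Section Induced.
Variables (G : sgraph) (A : {set G}).
Definition induced_adj : rel {x : G | x \in A} :=
  fun x y => adj (val x) (val y).
Lemma induced_adj_sym : symmetric induced_adj.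
Proof. by move=> x y; rewrite /induced_adj adj_sym. Qed.
Lemma induced_adj_irr : irreflexive induced_adj.
Proof. by move=> x; rewrite /induced_adj adj_irr. Qed.
Definition induced : sgraph :=
  SGraph {x : G | x \in A} induced_adj induced_adj_sym induced_adj_irr.
End Induced.

Section Complete.
Variable n : nat.
Definition complete_adj : rel 'I_n := fun x y => x != y.
Lemma complete_adj_sym : symmetric complete_adj.
Proof. by move=> x y; rewrite /complete_adj eq_sym. Qed.
Lemma complete_adj_irr : irreflexive complete_adj.
Proof. by move=> x; rewrite /complete_adj eqxx. Qed.
Definition complete_graph : sgraph :=
  SGraph 'I_n complete_adj complete_adj_sym complete_adj_irr.
End Complete.

Definition is_curve (R : realType) (c : set (R * R)) : Prop :=
  exists f : R -> R * R, {within `[0, 1], continuous f} /\ c = f @` `[0, 1].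

Definition string_graph (R : realType) (G : sgraph) : Prop :=
  exists c : G -> set (R * R),
    (forall v, is_curve (c v)) /\
    (forall u v : G, u != v -> (adj u v <-> c u `&` c v !=set0)).

(* A graph with one vertex has no biclique of positive size, so a lower bound
   n / 4 on the size is only meaningful for graphs with n >= 2 vertices. *)
Definition biclique (G : sgraph) (A B : {set G}) : Prop :=
  [/\ A :&: B = finset.set0, #|A| = #|B|
    & forall a b, a \in A -> b \in B -> adj a b].

(* A and B are arbitrary: they may overlap or coincide. The condition
   0 < delta < 1/2 is imposed where delta is introduced. *)
Definition graph_full (R : realType) (delta : R) (G : sgraph) : Prop :=
  forall A B : {set G},
    delta * (graph_order G)%:R <= #|A|%:R ->
    delta * (graph_order G)%:R <= #|B|%:R ->
    exists a b, [/\ a \in A, b \in B & adj a b].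

Definition graph_dense (R : realType) (alpha beta : R) (G : sgraph) : Prop :=
  forall A : {set G},
    alpha * (graph_order G)%:R <= #|A|%:R -> beta <= graph_density R (induced A).

(* Each edge of H occurs exactly once, oriented from the endpoint enumerated
   first to the other one; the orientation only serves to number the internal
   vertices of the path that replaces the edge. *)
Definition oedge (H : sgraph) : finType :=
  {p : H * H | adj p.1 p.2 && (enum_rank p.1 < enum_rank p.2)%N}.

Section Subdivision.
Variables (H : sgraph) (k : oedge H -> nat).

(* Branch-vertices are inl x; the i-th side-vertex on the path replacing e
   is inr (existT e i). *)
Definition subdiv_vertex : finType := (vertex H + {e : oedge H & 'I_(k e)})%type.

(* The consecutive pairs of the path
   (val e).1, (e, 0), ..., (e, k e - 1), (val e).2, listed in this order. *)
Definition subdiv_step (u v : subdiv_vertex) : bool :=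
  match u, v with
  | inl x, inr s => (x == (val (tag s)).1) && (tagged s == 0%N :> nat)
  | inr s, inr t =>
      (tag s == tag t) && (tagged t == (tagged s).+1 :> nat)
  | inr s, inl y =>
      ((tagged s).+1 == k (tag s)) && (y == (val (tag s)).2)
  | inl _, inl _ => false
  end.

Definition subdiv_adj : rel subdiv_vertex :=
  fun u v => subdiv_step u v || subdiv_step v u.
Lemma subdiv_adj_sym : symmetric subdiv_adj.
Proof. by move=> u v; rewrite /subdiv_adj orbC. Qed.
Lemma subdiv_adj_irr : irreflexive subdiv_adj.
Proof.
move=> [x|s] //; rewrite /subdiv_adj /= eqxx /= orbb.
by apply/negbTE; rewrite neq_ltn leqnn.
Qed.
Definition subdivision : sgraph :=
  SGraph subdiv_vertex subdiv_adj subdiv_adj_sym subdiv_adj_irr.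

Definition share_endpoint (e f : oedge H) : bool :=
  [exists x : H, (x \in [:: (val e).1; (val e).2]) &&
                 (x \in [:: (val f).1; (val f).2])].

Definition addable (u v : subdivision) : bool :=
  match u, v with
  | inr s, inr t => (tag s != tag t) && share_endpoint (tag s) (tag t)
  | _, _ => false
  end.
End Subdivision.

Definition weak_subdivision (H G : sgraph) : Prop :=
  exists k : oedge H -> nat, (forall e, (0 < k e)%N) /\
  exists f : G -> subdivision k,
    [/\ bijective f,
        forall x y, adj (f x) (f y) -> adj x y
      & forall x y, adj x y -> adj (f x) (f y) \/ addable (f x) (f y)].

(* Containment is as an induced subgraph: with non-induced containment, the
   restriction on the added edges would have no effect. *)
Definition contains_weak_subdivision (G H : sgraph) : Prop :=
  exists A : {set G}, weak_subdivision H (induced A).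

(* Main.v *)
(* Call d(A, B) the edge density between vertex sets A and B.  After passing to a
   large set W of maximum degree at most (1/4 - eps/2)|W|, take five large
   subsets V_1, ..., V_5 of W almost minimizing the sum of all d(V_i, V_j), in
   such a way that no much smaller sets do noticeably better.  Replacing V_k by W
   cannot decrease the sum, and d(W, -) is below 1/4, so the densities from V_k to
   the four other sets add up to less than 1.  As the sum is affine in each V_i,
   this remains true for all not too small subsets U_i of V_i: no two typical
   vertices in U_i and U_j have neighborhoods covering U_k.  Hence one can choose
   greedily branch-vertices v_i (with U_i shrunk to neighbors of v_i, by the
   density of G), then for each pair i, j an edge between U_i and U_j (by
   fullness), each time deleting from the other U_k the neighbors of the vertices
   just chosen.  Every edge of K_5 becomes a path with two side-vertices. *)
Require Import Defs.
From mathcomp Require Import all_boot all_order all_algebra.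
From mathcomp Require Import reals.
From mathcomp Require Import ring lra zify.

Set Implicit Arguments.
Unset Strict Implicit.
Unset Printing Implicit Defensive.

Import Order.TTheory GRing.Theory Num.Theory.
Local Open Scope ring_scope.

(** * Counting edges between vertex sets *)

Section EdgeCounts.
Variable G : sgraph.
Implicit Types (A B D : {set G}) (x y : G).

Definition nbr x : {set G} := [set y | adj x y].

(** Adjacent pairs are counted as ordered pairs and the two sets may overlap, so [ecount A A] is
    twice the number of edges inside [A]. *)
Definition ecount A B : nat := (\sum_(x in A) #|nbr x :&: B|)%N.

Lemma ecountE A B : ecount A B = (\sum_(x in A) \sum_(y in B) adj x y)%N.
Proof.
apply: eq_bigr => x _; rewrite -sum1_card big_mkcond [RHS]big_mkcond /=.
by apply: eq_bigr => y _; rewrite !inE; case: adj; case: (y \in B).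
Qed.

Lemma ecountC A B : ecount A B = ecount B A.
Proof.
rewrite !ecountE exchange_big; apply: eq_bigr => x _; apply: eq_bigr => y _.
by rewrite adj_sym.
Qed.

Lemma ecount_le A B : (ecount A B <= #|A| * #|B|)%N.
Proof.
rewrite -sum_nat_const; apply: leq_sum => x _.
exact/subset_leq_card/subsetIr.
Qed.

Lemma ecount_split A B D : A \subset B ->
  ecount B D = (ecount A D + ecount (B :\: A) D)%N.
Proof. by move=> /setIidPr sAB; rewrite /ecount (big_setID A) sAB. Qed.

Lemma ecount_ge A D t : (forall x, x \in A -> t <= #|nbr x :&: D|)%N ->
  (#|A| * t <= ecount A D)%N.
Proof. by move=> h; rewrite -sum_nat_const; apply: leq_sum. Qed.

Lemma card_adj_pairs A B :
  #|[set p : G * G | [&& p.1 \in A, p.2 \in B & adj p.1 p.2]]| = ecount A B.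
Proof.
rewrite ecountE pair_big_dep /= -sum1_card big_mkcond [RHS]big_mkcond /=.
apply: eq_bigr => -[x y] _; rewrite inE /=.
by case: (x \in A); case: (y \in B); case: adj.
Qed.

(** Ordered adjacent pairs are grouped by their underlying edge; each fibre has at most two
    elements. *)
Lemma ecount_setT_le : (ecount setT setT <= 2 * #|edges G|)%N.
Proof.
rewrite -card_adj_pairs -sum1_card.
pose F (p : G * G) := [set p.1; p.2].
rewrite (partition_big F (fun S => S \in edges G)) /=; last first.
  move=> [x y]; rewrite !inE /= => xy; apply/existsP; exists x; apply/existsP.
  by exists y; rewrite xy eqxx.
rewrite mulnC -sum_nat_const; apply: leq_sum => S.
rewrite inE => /existsP[x /existsP[y /andP[xy /eqP ->]]].
rewrite sum1_card; apply: (@leq_trans #|[set (x, y); (y, x)]|); last first.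
  by rewrite cards2; case: eqP.
apply/subset_leq_card/subsetP => -[u v].
rewrite unfold_in => /andP[]; rewrite !inE /= => uv /eqP E.
have := adj_irr u; have := adj_irr x.
have : u \in [set x; y] by rewrite -E !inE eqxx.
have : v \in [set x; y] by rewrite -E !inE eqxx orbT.
rewrite !inE => /orP[]/eqP ev /orP[]/eqP eu; subst u v; rewrite ?eqxx ?orbT //.
  by rewrite uv.
by rewrite uv.
Qed.

(** Every edge comes from some ordered pair. The factor 2 is given away, since the density of [G]
    serves only as a lower bound. *)
Lemma edges_induced_le A : (#|edges (induced A)| <= ecount A A)%N.
Proof.
pose H := induced A.
pose P := [set p : H * H | adj p.1 p.2].
apply: (@leq_trans #|[set [set p.1; p.2] | p in P]|).
  apply/subset_leq_card/subsetP => S.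
  rewrite inE => /existsP[x /existsP[y /andP[xy /eqP ->]]].
  by apply/imsetP; exists (x, y); rewrite ?inE.
apply: leq_trans (leq_imset_card _ _) _.
rewrite -card_adj_pairs.
pose g (p : H * H) : G * G := (val p.1, val p.2).
have g_inj : injective g by move=> [a b] [c d] [/val_inj -> /val_inj ->].
rewrite -(card_imset _ g_inj); apply/subset_leq_card/subsetP => q.
move=> /imsetP[[a b]]; rewrite !inE /= => ab -> /=.
by rewrite (valP a) (valP b).
Qed.

Lemma ecount_setD1 A x : x \in A ->
  ecount A A = (ecount (A :\ x) (A :\ x) + 2 * #|nbr x :&: A|)%N.
Proof.
move=> xA; have x1 : [set x] \subset A by rewrite sub1set.
have e1 B : ecount [set x] B = #|nbr x :&: B| by rewrite /ecount big_set1.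
rewrite (ecount_split _ x1) e1 (ecountC (A :\ x) A) (ecount_split _ x1) e1.
suff -> : nbr x :&: A = nbr x :&: (A :\ x) by lia.
by apply/setP => y; rewrite !inE; case: eqP => // ->; rewrite adj_irr.
Qed.

End EdgeCounts.

(** * A large vertex set of low maximum degree *)

Section Core.
Variable R : realType.

(* Deleting a vertex cannot decrease [ecount W W - lam * #|W| ^ 2] when W
   minimizes it, which bounds the degree of that vertex. *)
Lemma low_degree_core (G : sgraph) (lam eps : R) :
  lam <= 1 -> 0 < eps <= 1 ->
  (ecount [set: G] setT)%:R <= (lam - eps) * (graph_order G)%:R ^+ 2 ->
  exists W : {set G}, eps * (graph_order G)%:R <= #|W|%:R /\
    forall x, x \in W -> #|nbr x :&: W|%:R <= lam * #|W|%:R.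
Proof.
move=> lam1 /andP[eps0 eps1]; set n := (graph_order G)%:R; move=> hE.
pose g (W : {set G}) : R := (ecount W W)%:R - lam * #|W|%:R ^+ 2.
have [W _ Wmin] := @arg_minP _ R _ (setT : {set G}) predT g isT.
have n0 : 0 <= n by exact: ler0n.
have gW : g W <= - eps * n ^+ 2.
  by apply: le_trans (Wmin setT isT) _; rewrite /g cardsT -/n; nra.
have W0 : 0 <= #|W|%:R :> R by exact: ler0n.
exists W; split.
  (* As [ecount W W] is non-negative, [gW] gives [#|W|^2 >= lam * #|W|^2 >= eps * n^2 >= (eps *
     n)^2]. *)
  rewrite -(@ler_pXn2r _ 2) ?nnegrE ?mulr_ge0 //; last exact: ltW.
  have e0 : 0 <= (ecount W W)%:R :> R by exact: ler0n.
  move: gW; rewrite /g; move: (#|W|%:R) W0 => w w0 gW.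
  have h1 : lam * w ^+ 2 <= w ^+ 2 by rewrite ler_piMl // sqr_ge0.
  have h2 : eps * n ^+ 2 * eps <= eps * n ^+ 2.
    by rewrite ler_piMr ?mulr_ge0 ?sqr_ge0 // ltW.
  by rewrite exprMn; lra.
move=> x xW; have := Wmin (W :\ x) isT.
rewrite /g (ecount_setD1 xW) natrD natrM (cardsD1 x W) xW natrD /=.
rewrite (_ : (1 : nat)%:R = 1 :> R) //.
have := ler0n R #|W :\ x|; have := ler0n R #|nbr x :&: W|.
set w : R := #|W :\ x|%:R; set d : R := #|nbr x :&: W|%:R => d0 w0 hmin.
(* Here [#|W| = w + 1], so [d <= lam * (w + 1/2)] suffices once [lam >= 0]; that sign follows from
   [0 <= 2 * d]. *)
have h : 2 * d <= lam * (2 * w + 1) by lra.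
have lam0 : 0 <= lam.
  by rewrite -(@pmulr_lge0 _ (2 * w + 1)) ?(le_trans _ h) //; lra.
lra.
Qed.

End Core.

(** * Density potential of tuples of sets, and stable tuples *)

Section Potential.
Variables (R : realType) (G : sgraph) (h : nat).
Implicit Types (A B D Z : {set G}) (U V : 'I_h -> {set G}).

(** Division by zero makes this 0 when a set is empty. *)
Definition pair_density A B : R := (ecount A B)%:R / (#|A|%:R * #|B|%:R).

Lemma pair_density_ge0 A B : 0 <= pair_density A B.
Proof. by rewrite divr_ge0 ?mulr_ge0. Qed.

Lemma pair_density_le1 A B : pair_density A B <= 1.
Proof.
rewrite /pair_density -natrM; have [->|AB0] := posnP (#|A| * #|B|)%N.
  by rewrite invr0 mulr0.
by rewrite ler_pdivrMr ?ltr0n // mul1r ler_nat ecount_le.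
Qed.

Lemma pair_densityC A B : pair_density A B = pair_density B A.
Proof. by rewrite /pair_density ecountC mulrC (mulrC #|A|%:R) mulrC. Qed.

(** Weighted by [#|A|], the density becomes additive in [A]. This is the source of all affinity
    arguments below. *)
Lemma pair_density_mulr A D :
  pair_density A D * #|A|%:R = (ecount A D)%:R / #|D|%:R.
Proof.
have [A0|A0] := posnP #|A|.
  by have := ecount_le A D; rewrite A0 mul0n leqn0 mulr0 => /eqP->; rewrite mul0r.
have A0' : #|A|%:R != 0 :> R by rewrite pnatr_eq0 -lt0n.
by rewrite /pair_density invfM mulrA mulrAC mulfVK.
Qed.

Definition upd V k Z : 'I_h -> {set G} := fun i => if i == k then Z else V i.

Definition star V k Z : R := \sum_(j < h | j != k) pair_density Z (V j).

(** Each unordered pair of indices contributes twice, whence the factor 2 in front of [star]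
    below. *)
Definition potential V : R :=
  \sum_(i < h) \sum_(j < h | j != i) pair_density (V i) (V j).

Definition potential_rest V k : R :=
  \sum_(i < h | i != k) \sum_(j < h | (j != i) && (j != k))
    pair_density (V i) (V j).

Lemma eq_potential U V : U =1 V -> potential U = potential V.
Proof.
by move=> UV; apply: eq_bigr => i _; apply: eq_bigr => j _; rewrite !UV.
Qed.

Lemma potential_upd V k Z :
  potential (upd V k Z) = 2 * star V k Z + potential_rest V k.
Proof.
rewrite /potential (bigD1 k) //= (_ : \sum_(j < h | _) _ = star V k Z); last first.
  by apply: eq_bigr => j jk; rewrite /upd eqxx (negPf jk).
rewrite mulr_natl mulr2n -addrA; congr (_ + _).
rewrite /star /potential_rest -big_split /=; apply: eq_bigr => i ik.
rewrite (bigD1 k) 1?eq_sym //= /upd eqxx (negPf ik) pair_densityC; congr (_ + _).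
by apply: eq_bigr => j /andP[_ jk]; rewrite (negPf jk).
Qed.

Lemma potentialE V k :
  potential V = 2 * star V k (V k) + potential_rest V k.
Proof.
rewrite -potential_upd; apply: eq_potential => i.
by rewrite /upd; case: eqP => // ->.
Qed.

Lemma potential_ge0 V : 0 <= potential V.
Proof. by do 2![apply: sumr_ge0 => ? _]; apply: pair_density_ge0. Qed.

Lemma potential_le V : potential V <= h%:R ^+ 2.
Proof.
rewrite /potential; apply: (@le_trans _ _ (\sum_(i < h) h%:R)); last first.
  by rewrite sumr_const card_ord expr2 mulr_natl.
apply: ler_sum => i _; rewrite -[leRHS]mulr1 mulr_natl -[X in _ *+ X]card_ord.
rewrite -sumr_const big_mkcond; apply: ler_sum => j _.
by case: ifP => _; rewrite ?pair_density_le1.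
Qed.

Lemma star_split V k A B : A \subset B ->
  star V k B * #|B|%:R =
  star V k A * #|A|%:R + star V k (B :\: A) * #|B :\: A|%:R.
Proof.
move=> sAB; rewrite /star !mulr_suml -big_split; apply: eq_bigr => j _ /=.
by rewrite !pair_density_mulr (ecount_split _ sAB) natrD mulrDl.
Qed.

Lemma potential_split V k A B : A \subset B ->
  potential (upd V k B) * #|B|%:R =
  potential (upd V k A) * #|A|%:R
  + potential (upd V k (B :\: A)) * #|B :\: A|%:R.
Proof.
move=> sAB; rewrite !potential_upd !mulrDl -!mulrA (star_split _ _ sAB).
have -> : #|B|%:R = #|A|%:R + #|B :\: A|%:R :> R.
  by rewrite -natrD -(cardsID A B) (setIidPr sAB).
by ring.
Qed.

(** The competitors [U i] range over subsets of [W], not of [V i]: a coordinate may be replaced by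
    [W] itself. *)
Definition stable_tuple (W : {set G}) (kap tau : R) V :=
  forall U, (forall i, U i \subset W /\ kap * #|V i|%:R <= #|U i|%:R) ->
  potential V - tau <= potential U.

(* Otherwise the potential could be lowered K times by tau. *)
Lemma stable_tuple_exists (W : {set G}) (kap tau : R) K :
  0 < kap <= 1 -> h%:R ^+ 2 < tau * K%:R ->
  exists V, [/\ forall i, V i \subset W,
                forall i, kap ^+ K * #|W|%:R <= #|V i|%:R
              & stable_tuple W kap tau V].
Proof.
move=> /andP[kap0 kap1] hK; set concl := exists V, _.
have loop j : (j <= K)%N -> concl \/ exists V, [/\ forall i, V i \subset W,
    forall i, kap ^+ j * #|W|%:R <= #|V i|%:R
    & potential V <= h%:R ^+ 2 - tau * j%:R].
  elim: j => [_|j IH jK].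
    right; exists (fun=> W); split=> // [i|]; first by rewrite expr0 mul1r.
    by rewrite mulr0 subr0 potential_le.
  have [|[V [VW Vs Vp]]] := IH (ltnW jK); [by left|].
  have [Vst|] := boolp.EM (stable_tuple W kap tau V).
    left; exists V; split=> // i; apply: le_trans (Vs i).
    by rewrite ler_wpM2r // ler_wiXn2l // ?ltW // ltnW.
  move=> /boolp.existsNP[U /boolp.not_implyP[UW /negP]]; rewrite -ltNge => Up.
  right; exists U; split=> [i|i|]; first by case: (UW i).
    have [_] := UW i; apply: le_trans.
    by rewrite exprS -mulrA ler_wpM2l // ltW.
  by rewrite -natr1 mulrDr mulr1; lra.
have [//|[V [_ _ Vp]]] := loop K (leqnn K).
by have := potential_ge0 V; lra.
Qed.

(** Coordinates are replaced one at a time, tracking the excess over the floor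
    [M = potential V - tau]. The old potential is a weighted average of those for [U k] and
    [V k :\: U k]. Both are at least [M] by stability and [U k] has weight at least [kap], so each
    replacement multiplies the excess, initially at most [tau], by at most [1 / kap]. *)
Lemma stable_subtuple_potential W kap tau V U :
  0 < kap <= 1 -> 0 <= tau -> stable_tuple W kap tau V ->
  (forall i, V i \subset W) -> (forall i, (0 < #|V i|)%N) ->
  (forall i, U i \subset V i) ->
  (forall i, kap * #|V i|%:R <= #|U i|%:R) ->
  (forall i, kap * #|V i|%:R <= #|V i :\: U i|%:R) ->
  potential U <= potential V - tau + tau / kap ^+ h.
Proof.
move=> /andP[kap0 kap1] tau0 Vst VW V0 UV Ubig UDbig.
pose P r (i : 'I_h) := if (i < r)%N then U i else V i.
have kapV i : kap * #|V i|%:R <= #|V i|%:R by rewrite ler_piMl.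
suff loop r : (r <= h)%N ->
    potential (P r) <= potential V - tau + tau / kap ^+ r.
  by rewrite (@eq_potential U (P h)) ?loop // => i; rewrite /P ltn_ord.
elim: r => [_|r IH rh].
  by rewrite expr0 divr1 (@eq_potential (P 0%N) V) //; lra.
pose k := Ordinal rh; set M := potential V - tau.
have PrE Z i : upd (P r) k Z i =
    if i == k then Z else if (i < r)%N then U i else V i by [].
have bound Z : Z \subset W -> kap * #|V k|%:R <= #|Z|%:R ->
    M <= potential (upd (P r) k Z).
  move=> ZW Zbig; apply: Vst => i; rewrite PrE; case: eqP => [->//|_].
  by case: ifP => _; split=> //; apply: subset_trans (UV i) (VW i).
have e0 : potential (P r) = potential (upd (P r) k (V k)).
  apply: eq_potential => i; rewrite PrE; case: eqP => // ->.
  by rewrite /P /= ltnn.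
have e1 : potential (P r.+1) = potential (upd (P r) k (U k)).
  apply: eq_potential => i; rewrite PrE /P ltnS leq_eqVlt.
  by rewrite (_ : (i == r :> nat) = (i == k)) //; case: eqP => // ->.
have := potential_split (P r) k (UV k); rewrite -e0 -e1.
have b1 := bound (U k) (subset_trans (UV k) (VW k)) (Ubig k).
have b2 := bound (V k :\: U k) (subset_trans (subsetDl _ _) (VW k)) (UDbig k).
rewrite -e1 in b1.
have := IH (ltnW rh); rewrite -/M.
have Vk : #|V k|%:R = #|U k|%:R + #|V k :\: U k|%:R :> R.
  by rewrite -natrD -(cardsID (U k) (V k)) (setIidPr (UV k)).
move: b1 b2 (Ubig k); set X := potential (P r); set X' := potential (P r.+1).
set X'' := potential _; move=> b1 b2 hU hX hsplit.
have v0 : 0 < #|V k|%:R :> R by rewrite ltr0n.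
have key : kap * (X' - M) <= X - M.
  rewrite -(ler_pM2r v0).
  have : kap * #|V k|%:R * (X' - M) <= #|U k|%:R * (X' - M).
    by rewrite ler_wpM2r // subr_ge0.
  have : 0 <= #|V k :\: U k|%:R * (X'' - M) by rewrite mulr_ge0 // subr_ge0.
  move: hsplit; rewrite Vk; lra.
rewrite -lerBlDl exprS invfM mulrCA mulrC ler_pdivlMr // mulrC.
by apply: le_trans key _; rewrite lerBlDl.
Qed.

(** By symmetry, the density between [W] and [U j] is the average over [x] in [U j] of the fraction
    of [W] adjacent to [x]. *)
Lemma star_core_le (W : {set G}) (lam : R) U k :
  (forall x, x \in W -> #|nbr x :&: W|%:R <= lam * #|W|%:R) ->
  (forall i, U i \subset W) -> (forall i, (0 < #|U i|)%N) ->
  star U k W <= lam * h.-1%:R.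
Proof.
move=> hW UW U0; apply: (@le_trans _ _ (\sum_(j < h | j != k) lam)).
  apply: ler_sum => j _; rewrite pair_densityC /pair_density.
  have Uj : 0 < #|U j|%:R :> R by rewrite ltr0n.
  have W0 : 0 < #|W|%:R :> R.
    by rewrite ltr0n (leq_trans (U0 j)) // subset_leq_card.
  rewrite ler_pdivrMr ?mulr_gt0 // mulrCA mulr_natl -sumr_const.
  rewrite /ecount natr_sum; apply: ler_sum => x xU.
  by apply: hW; apply: subsetP xU.
by rewrite sumr_const cardC1 card_ord mulr_natr.
Qed.

Lemma exists_subset_card A m : (m <= #|A|)%N ->
  exists2 B : {set G}, B \subset A & #|B| = m.
Proof.
move=> mA; exists [set x in take m (enum A)].
  by apply/subsetP => x; rewrite inE => /mem_take; rewrite mem_enum.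
rewrite cardsE (card_uniqP _) ?take_uniq ?enum_uniq // size_take -cardE.
by case: ltngtP mA.
Qed.

(* The potential is affine in each coordinate, so near a stable tuple it is
   almost constant on subtuples; exchanging the k-th coordinate with W then
   bounds the k-th star of every subtuple by the average degree. *)
Lemma hereditary_tuple (W : {set G}) (lam eps kap : R) K :
  (forall x, x \in W -> #|nbr x :&: W|%:R <= lam * #|W|%:R) ->
  0 <= eps -> 0 < kap <= 2^-1 -> h%:R ^+ 2 < eps * kap ^+ h * K%:R ->
  2 <= kap ^+ K * #|W|%:R ->
  exists V (m : 'I_h -> R),
   [/\ forall i, kap ^+ K.+1 * #|W|%:R <= m i,
       forall i, m i <= 3 * kap * #|V i|%:R
     & forall U, (forall i, U i \subset V i /\ m i <= #|U i|%:R) ->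
       forall k, star U k (U k) <= lam * h.-1%:R + eps].
Proof.
move=> hW eps0 /andP[kap0 kap2] hK big.
have kap1 : 0 < kap <= 1 by apply/andP; split=> //; lra.
have [V [VW Vbig Vst]] := stable_tuple_exists W kap1 hK.
have V2 i : (2 <= #|V i|)%N by rewrite -(ler_nat R) (le_trans big).
(* Passing to halves ensures that every subset of [V0 i] leaves a complement in [V i] of size at
   least [kap * #|V i|], as the affinity argument requires. *)
have half i : exists B : {set G}, (B \subset V i) && (#|B| == #|V i|./2).
  have [|B sB /eqP cB] := @exists_subset_card (V i) #|V i|./2; first by lia.
  by exists B; rewrite sB.
pose V0 i := xchoose (half i).
have V0V i : V0 i \subset V i by have /andP[] := xchooseP (half i).
have cV0 i : #|V0 i| = #|V i|./2 by have /andP[_ /eqP] := xchooseP (half i).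
exists V0, (fun i => kap * #|V i|%:R); split=> [i|i|U hU k].
- by rewrite exprS -mulrA ler_pM2l.
(* The factor is 3 rather than 2 because the half is rounded down. *)
- have : (#|V i| <= 3 * #|V0 i|)%N by rewrite cV0; have := V2 i; lia.
  by rewrite -(ler_nat R) natrM -(ler_pM2l kap0); lra.
have UV i : U i \subset V i by apply: subset_trans (V0V i); case: (hU i).
have Ubig i : kap * #|V i|%:R <= #|U i|%:R by case: (hU i).
have V0' i : (0 < #|V i|)%N by apply: ltnW.
have UDbig i : kap * #|V i|%:R <= #|V i :\: U i|%:R.
  have : (#|U i| <= #|V i|./2)%N by rewrite -cV0 subset_leq_card //; case: (hU i).
  have := cardsID (U i) (V i); rewrite (setIidPr (UV i)) => cU cU2.
  have : (#|V i| <= 2 * #|V i :\: U i|)%N by lia.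
  by rewrite -(ler_nat R) natrM; have := ler0n R #|V i|; nra.
have kh0 : 0 < kap ^+ h by rewrite exprn_gt0.
have tau0 : 0 <= eps * kap ^+ h by rewrite mulr_ge0 // ltW.
have := stable_subtuple_potential kap1 tau0 Vst VW V0' UV Ubig UDbig.
have U0 i : (0 < #|U i|)%N.
  by rewrite -(ltr0n R) (lt_le_trans _ (Ubig i)) // mulr_gt0 // ltr0n.
have UW i : U i \subset W by apply: subset_trans (VW i).
have := star_core_le k hW UW U0.
(* The subtuple exceeds the floor by at most [eps], while the tuple with [W] at [k] is not below it.
   The common part [potential_rest U k] cancels. *)
have : potential V - eps * kap ^+ h <= potential (upd U k W).
  apply: Vst => i; rewrite /upd; case: eqP => // _; split=> //.
  apply: (@le_trans _ _ #|V i|%:R); last by rewrite ler_nat subset_leq_card.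
  by rewrite ler_piMl //; lra.
rewrite mulfK ?gt_eqF // (potentialE U k) potential_upd.
lra.
Qed.

End Potential.

(** * Greedy embedding of a weak subdivision of a complete graph *)

Lemma contains_weak_subdivision_embedding (H G : sgraph) (k : oedge H -> nat)
    (g : subdivision k -> G) :
  (forall e, (0 < k e)%N) -> injective g ->
  (forall u w, adj u w -> adj (g u) (g w)) ->
  (forall u w, adj (g u) (g w) -> adj u w \/ addable u w) ->
  contains_weak_subdivision G H.
Proof.
move=> k0 g_inj g_adj g_adjV; pose A := [set g u | u : subdivision k].
have gA u : g u \in A by apply: imset_f.
have f_ex (x : induced A) : exists u, g u == val x.
  by have /imsetP[u _ ->] := valP x; exists u.
(* The definition asks for a map from the induced subgraph to the subdivision, so [g] is inverted on
   its image. *)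
pose f x := xchoose (f_ex x).
have gf x : g (f x) = val x by apply/eqP/(xchooseP (f_ex x)).
exists A, k; split=> //; exists f; split.
- exists (fun u => exist _ (g u) (gA u) : induced A) => [x|u].
    by apply: val_inj; rewrite /= gf.
  by apply: g_inj; rewrite gf.
- by move=> x y /g_adj; rewrite !gf.
- by move=> x y xy; apply: g_adjV; rewrite !gf.
Qed.

Section Embedding.
Variables (R : realType) (G : sgraph) (h : nat) (x0 : G).
Variables (V : 'I_h -> {set G}) (m : 'I_h -> R) (eps C theta : R) (Q : nat).
Implicit Types (A B D : {set G}) (U : 'I_h -> {set G}) (i j k : 'I_h).

Hypothesis C_gt0 : 0 < C.
Hypothesis theta_gt0 : 0 < theta.
Hypothesis theta_half : theta <= 2^-1.
Hypothesis eps_le1 : eps <= 1.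
Hypothesis theta_eps : 2 * theta <= eps.
Hypothesis theta_C : 2 * theta <= C.
Hypothesis m_big : forall i, 4 <= eps * m i.
Hypothesis V_big : forall i, 2 * h.+1%:R * m i <= theta ^+ Q * #|V i|%:R.
Hypothesis V_full : forall i j A B, m i <= #|A|%:R -> m j <= #|B|%:R ->
  exists a b, [/\ a \in A, b \in B & adj a b].
Hypothesis V_dense : forall i A, m i <= #|A|%:R ->
  C * #|A|%:R ^+ 2 <= (ecount A A)%:R.
Hypothesis V_star : forall U, (forall i, U i \subset V i /\ m i <= #|U i|%:R) ->
  forall k, star R U k (U k) <= 1 - eps.

Let eps_gt0 : 0 < eps. Proof. have := theta_gt0; have := theta_eps; lra. Qed.

Lemma threshold_gt0 i : 0 < m i.
Proof. by rewrite -(pmulr_rgt0 _ eps_gt0); have := m_big i; lra. Qed.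

(** The factor [2 * h.+1] leaves room to delete [h] exceptional sets of size at most [m i] and keep
    both half of [U i] and [m i] vertices. *)
Definition large_subtuple U :=
  forall i, U i \subset V i /\ 2 * h.+1%:R * m i <= #|U i|%:R.

Lemma large_subtuple_m U i : large_subtuple U -> m i <= #|U i|%:R.
Proof.
move=> /(_ i)[_]; apply: le_trans; rewrite ler_peMl ?ltW ?threshold_gt0 //.
by have := ler1n R h.+1; rewrite ltnS leq0n; lra.
Qed.

(** [Q] is the budget of shrinking steps: each choice of a branch-vertex or of a connecting edge
    costs one factor [theta]. *)
Lemma large_subtuple_theta U r : (r <= Q)%N -> (forall i, U i \subset V i) ->
  (forall i, theta ^+ r * #|V i|%:R <= #|U i|%:R) -> large_subtuple U.
Proof.
move=> rQ UV Ubig i; split=> //; apply: le_trans (V_big i) _.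
apply: le_trans (Ubig i); rewrite ler_wpM2r // ler_wiXn2l //; first exact: ltW.
by have := theta_half; lra.
Qed.

Lemma ecount_average_le A D (t : R) : (0 < #|A|)%N ->
  t * #|A|%:R <= (ecount A D)%:R -> t <= pair_density R D A * #|D|%:R.
Proof.
move=> A0 ht; rewrite pair_density_mulr ecountC ler_pdivlMr //.
by rewrite ltr0n.
Qed.

(** With [A] and [B] substituted at [i] and [j], the star at [k] contains both densities, and its
    other terms are non-negative. *)
Lemma star_pair_le U i j k A B (s t : R) : large_subtuple U ->
  i != j -> i != k -> j != k -> A \subset U i -> B \subset U j ->
  m i <= #|A|%:R -> m j <= #|B|%:R ->
  s * #|A|%:R <= (ecount A (U k))%:R -> t * #|B|%:R <= (ecount B (U k))%:R ->
  s + t <= (1 - eps) * #|U k|%:R.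
Proof.
move=> UL ij ik jk AU BU Am Bm hs ht.
pose U' := upd (upd U j B) i A.
have U'i : U' i = A by rewrite /U' /upd eqxx.
have U'j : U' j = B by rewrite /U' /upd eq_sym (negPf ij) eqxx.
have U'k : U' k = U k.
  by rewrite /U' /upd !(eq_sym k) (negPf ik) (negPf jk).
have := V_star (U := U') _ k.
have pos i' D : m i' <= #|D|%:R -> (0 < #|D|)%N.
  by rewrite -(ltr0n R); apply: lt_le_trans (threshold_gt0 i').
have hs' := ecount_average_le (pos _ _ Am) hs.
have ht' := ecount_average_le (pos _ _ Bm) ht.
move=> H; apply: le_trans (lerD hs' ht') _; rewrite -mulrDl ler_wpM2r //.
apply: le_trans (H _); last first.
  move=> l; rewrite /U' /upd; case: eqP => [->|_].
    by split=> //; apply: subset_trans AU _; case: (UL i).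
  case: eqP => [->|_]; first by split=> //; apply: subset_trans BU _; case: (UL j).
  by split; [case: (UL l)|apply: large_subtuple_m].
rewrite /star U'k (bigD1 i) //= (bigD1 j) /=; last by rewrite jk eq_sym.
rewrite U'i U'j addrA lerDl; apply: sumr_ge0 => l _.
exact: pair_density_ge0.
Qed.

Lemma star_single_le U i k A (s : R) : large_subtuple U -> i != k ->
  A \subset U i -> m i <= #|A|%:R ->
  s * #|A|%:R <= (ecount A (U k))%:R -> s <= (1 - eps) * #|U k|%:R.
Proof.
move=> UL ik AU Am hs; have A0 : (0 < #|A|)%N.
  by rewrite -(ltr0n R); apply: lt_le_trans (threshold_gt0 i) Am.
apply: le_trans (ecount_average_le A0 hs) _; rewrite ler_wpM2r //.
have U'k : upd U i A k = U k by rewrite /upd eq_sym (negPf ik).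
have U'i : upd U i A i = A by rewrite /upd eqxx.
apply: le_trans (V_star (U := upd U i A) _ k); last first.
  move=> l; rewrite /upd; case: eqP => [->|_].
    by split=> //; apply: subset_trans AU _; case: (UL i).
  by split; [case: (UL l)|apply: large_subtuple_m].
rewrite /star U'k (bigD1 i) //= U'i lerDl; apply: sumr_ge0 => l _.
exact: pair_density_ge0.
Qed.

(** Take the least [t] exceeded by the degrees of at most [l] vertices. By minimality more than [l]
    vertices have degree at least [t], unless [t = 0], when [A] itself serves as [A']. *)
Lemma degree_threshold A D (l : R) : 0 < l <= #|A|%:R ->
  exists t, #|[set x in A | (t < #|nbr x :&: D|)%N]|%:R <= l /\
    exists A', [/\ A' \subset A, l <= #|A'|%:R
                 & t%:R * #|A'|%:R <= (ecount A' D)%:R :> R].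
Proof.
move=> /andP[l0 lA].
pose P t := #|[set x in A | (t < #|nbr x :&: D|)%N]|%:R <= l.
have exP : exists t, P t.
  exists #|D|; rewrite /P (_ : [set _ in _ | _] = set0) ?cards0 ?ltW //.
  apply/setP => x; rewrite !inE ltnNge subset_leq_card ?subsetIr //.
  by rewrite andbF.
case: (ex_minnP exP) => -[|t] Pt tmin; [exists 0%N|exists t.+1]; split=> //.
  by exists A; split; rewrite // mul0r.
exists [set x in A | (t < #|nbr x :&: D|)%N]; split.
- by apply/subsetP => x; rewrite inE => /andP[].
- have : ~~ P t by apply/negP => /tmin; rewrite ltnn.
  by rewrite /P -ltNge => /ltW.
rewrite -natrM ler_nat mulnC; apply: ecount_ge => x.
by rewrite inE => /andP[].
Qed.

Lemma card_setD_bigcup_ge A (F : 'I_h -> {set G}) (l : R) :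
  (forall k, #|F k|%:R <= l) ->
  #|A|%:R - h%:R * l <= #|A :\: \bigcup_k F k|%:R.
Proof.
move=> Fl; rewrite lerBlDr -lerBlDl.
apply: (@le_trans _ _ (\sum_k #|F k|)%:R); last first.
  rewrite natr_sum -[X in X%:R * _]card_ord mulr_natl -sumr_const.
  by apply: ler_sum.
rewrite lerBlDl -natrD ler_nat -(cardsID (\bigcup_k F k) A) addnC leq_add2l.
apply: leq_trans (subset_leq_card (subsetIr _ _)) _.
apply: (big_ind2 (fun (B : {set G}) n => #|B| <= n)%N) => //.
- by rewrite cards0.
- by move=> B b D d hB hD; rewrite (leq_trans (leq_card_setU B D)) ?leq_add.
Qed.

(* Discarding from [U i] and [U j] the vertices of top degree towards [U k],
   what remains has degrees bounded by the averages over the discarded sets,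
   and those two averages add up to at most [1 - eps]. *)
Lemma connecting_edge U i j : large_subtuple U -> i != j ->
  exists a b, [/\ a \in U i, b \in U j, adj a b & forall k, k != i -> k != j ->
    eps * #|U k|%:R <= #|U k :\: (nbr a :|: nbr b)|%:R].
Proof.
move=> UL ij.
(* [p] pairs a degree threshold towards [U k] with a set whose average degree attains it. *)
pose good l k (p : nat * {set G}) :=
  [/\ #|[set x in U l | (p.1 < #|nbr x :&: U k|)%N]|%:R <= m l,
      p.2 \subset U l, m l <= #|p.2|%:R
    & p.1%:R * #|p.2|%:R <= (ecount p.2 (U k))%:R :> R].
have thr l : exists f, forall k, good l k (f k).
  apply: fin_all_exists => k.
  have [|t [ht [A' [? ? ?]]]] := @degree_threshold (U l) (U k) (m l).
    by rewrite threshold_gt0 large_subtuple_m.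
  by exists (t, A').
have [f hf] := thr i; have [g hg] := thr j.
pose bad l (f : 'I_h -> nat * {set G}) k :=
  [set x in U l | ((f k).1 < #|nbr x :&: U k|)%N].
have big l F : (forall k, #|bad l F k|%:R <= m l) ->
    m l <= #|U l :\: \bigcup_k bad l F k|%:R.
  move=> /card_setD_bigcup_ge -/(_ (U l)); apply: le_trans.
  have := (UL l).2; have := threshold_gt0 l; have := ler0n R h.
  by rewrite -[h.+1%:R]natr1; nra.
have [|| a [b [+ + ab]]] := V_full (A := U i :\: \bigcup_k bad i f k)
  (B := U j :\: \bigcup_k bad j g k) (i := i) (j := j).
- by apply: big => k; case: (hf k).
- by apply: big => k; case: (hg k).
rewrite !inE => /andP[aN aU] /andP[bN bU].
exists a, b; split=> // k ki kj.
have degle l F x : x \in U l -> x \notin \bigcup_k bad l F k ->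
    (#|nbr x :&: U k| <= (F k).1)%N.
  move=> xU; apply: contraR; rewrite -ltnNge => lt.
  by apply/bigcupP; exists k; rewrite // inE xU.
have da := degle _ _ _ aU aN; have db := degle _ _ _ bU bN.
have [_ sf mf ef] := hf k; have [_ sg mg eg] := hg k.
have := star_pair_le UL ij _ _ sf sg mf mg ef eg.
rewrite ![_ == k]eq_sym => /(_ ki kj) hsum.
have : (#|U k| <= #|U k :\: (nbr a :|: nbr b)| + ((f k).1 + (g k).1))%N.
  rewrite -[leqLHS](cardsID (nbr a :|: nbr b)) addnC leq_add2l setIUr.
  apply: leq_trans (leq_card_setU _ _) _.
  by rewrite ![U k :&: _]setIC leq_add.
rewrite -(ler_nat R) !natrD; lra.
Qed.

(** For each [k], at most [m i] vertices of [U i] see more than a [1 - eps] fraction of [U k], by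
    the bound on stars. After deleting them for all [k], at least half of [U i] remains, and density
    yields a vertex of large degree inside this rest. *)
Lemma branch_vertex U i : large_subtuple U ->
  exists v, [/\ v \in U i, theta * #|U i|%:R <= #|nbr v :&: U i|%:R
    & forall k, k != i -> eps * #|U k|%:R <= #|U k :\: nbr v|%:R].
Proof.
move=> UL.
pose bad k := if k == i then set0
  else [set x in U i | (1 - eps) * #|U k|%:R < #|nbr x :&: U k|%:R].
have badm k : #|bad k|%:R <= m i.
  rewrite /bad; case: eqP => [_|/eqP ki].
    by rewrite cards0 ltW ?threshold_gt0.
  rewrite leNgt; apply/negP => lt; set B := [set x in _ | _] in lt.
  have [y yB] : exists y, y \in B.
    by apply/card_gt0P; rewrite -(ltr0n R) (lt_trans (threshold_gt0 i)).
  (* The star bound, applied with the least degree in [B] as [s], contradicts the membership of [z]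
     in [B]. *)
  have [z zB zmin] : exists2 z, z \in B &
      forall x, x \in B -> (#|nbr z :&: U k| <= #|nbr x :&: U k|)%N.
    case: (@arg_minnP _ y (mem B) (fun x => #|nbr x :&: U k|) yB) => z zB zmin.
    by exists z.
  have := zB; rewrite /B inE => /andP[_]; rewrite ltNge => /negP; apply.
  have BU : B \subset U i by apply/subsetP => x; rewrite inE => /andP[].
  have ik : i != k by rewrite eq_sym.
  apply: (star_single_le UL ik BU (ltW lt)).
  by rewrite -natrM ler_nat mulnC ecount_ge.
pose A := U i :\: \bigcup_k bad k.
have Ahalf : 2^-1 * #|U i|%:R <= #|A|%:R :> R.
  apply: (le_trans _ (card_setD_bigcup_ge (U i) badm)).
  have := (UL i).2; have := threshold_gt0 i; have := ler0n R h.
  by rewrite -[h.+1%:R]natr1; nra.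
have Am : m i <= #|A|%:R.
  apply: le_trans Ahalf; have := (UL i).2; have := threshold_gt0 i.
  by have := ler0n R h; rewrite -[h.+1%:R]natr1; nra.
have A0 : 0 < #|A|%:R :> R by apply: lt_le_trans Am; apply: threshold_gt0.
have [v vA vdeg] : exists2 v, v \in A & C * #|A|%:R <= #|nbr v :&: A|%:R.
  apply/exists_inP; rewrite -[X in is_true X]negbK negb_exists_in.
  apply/negP => /forall_inP lt.
  have := V_dense Am; rewrite leNgt => /negP; apply.
  have [y yA] : exists y, y \in A by apply/card_gt0P; rewrite -(ltr0n R).
  rewrite /ecount natr_sum expr2 mulrA mulr_natr -sumr_const.
  rewrite (bigD1 y) // [ltRHS](bigD1 y) //= ltr_leD //.
    by rewrite ltNge lt.
  by apply: ler_sum => x /andP[xA _]; rewrite ltW // ltNge lt.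
have := vA; rewrite /A inE => /andP[vN vU].
exists v; split=> // [|k ki].
  apply: (@le_trans _ _ (#|nbr v :&: A|%:R)).
    apply: le_trans vdeg; apply: (@le_trans _ _ (2 * theta * (2^-1 * #|U i|%:R))).
      by lra.
    by apply: ler_pM => //; rewrite mulr_ge0 ?invr_ge0 // ltW.
  by rewrite ler_nat subset_leq_card // setIS // subsetDl.
have : #|nbr v :&: U k|%:R <= (1 - eps) * #|U k|%:R.
  rewrite leNgt; apply: contra vN => lt; apply/bigcupP; exists k => //.
  by rewrite /bad (negPf ki) inE vU.
have := cardsID (nbr v) (U k); rewrite setIC => /(congr1 (GRing.natmul 1 : nat -> R)).
rewrite natrD; lra.
Qed.

Lemma theta_shrink (r : nat) (u u' w : R) :
  theta ^+ r * w <= u -> theta * u <= u' -> theta ^+ r.+1 * w <= u'.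
Proof.
by move=> h1; apply: le_trans; rewrite exprS -mulrA ler_wpM2l // ltW.
Qed.

(** Since [eps * #|U k| >= 4] and [2 * theta <= eps], half of [eps * #|U k|] pays for the at most
    two chosen vertices deleted from the set. *)
Lemma card_setD_ge U k A (c : nat) : large_subtuple U -> (c <= 2)%N ->
  eps * #|U k|%:R - c%:R <= #|A|%:R -> theta * #|U k|%:R <= #|A|%:R.
Proof.
move=> UL c2; apply: le_trans.
have : c%:R <= 2 :> R by rewrite ler_nat.
have := m_big k; have := large_subtuple_m k UL.
rewrite -(ler_pM2l eps_gt0) => h1 h2 h3.
have : 2 * theta * #|U k|%:R <= eps * #|U k|%:R by rewrite ler_wpM2r.
lra.
Qed.

(** Invariant of the greedy choice of branch-vertices. The values of [v] from index [r] on are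
    arbitrary. *)
Definition branch_state (r : nat) (v : 'I_h -> G) U :=
  [/\ (forall i, U i \subset V i) /\
      (forall i, theta ^+ r * #|V i|%:R <= #|U i|%:R),
      forall i x, (i < r)%N -> x \in U i -> adj (v i) x,
      forall i j x, (i < r)%N -> j != i -> x \in U j ->
        x != v i /\ ~~ adj (v i) x
    & forall i j, (i < r)%N -> (j < r)%N -> i != j ->
        v i != v j /\ ~~ adj (v i) (v j)].

Lemma branch_state_exists r : (r <= h)%N -> (r <= Q)%N ->
  exists v U, branch_state r v U.
Proof.
elim: r => [_ _|r IH rh rQ].
  by exists (fun=> x0), V; split=> //; split=> // i; rewrite expr0 mul1r.
have [v [U [[UV Ubig] st1 st2 st3]]] := IH (ltnW rh) (ltnW rQ).
have UL := large_subtuple_theta (ltnW rQ) UV Ubig.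
pose k := Ordinal rh; have [w [wU wbig wk]] := branch_vertex k UL.
have ltS i : (i < r.+1)%N = (i == k) || (i < r)%N by rewrite ltnS leq_eqVlt.
have ltk i : (i < r)%N -> (i == k) = false.
  by move=> ir; apply/eqP => ik; move: ir; rewrite ik ltnn.
pose v' i := if i == k then w else v i.
(* In class [k], irreflexivity already excludes [w]; elsewhere it is removed explicitly, which is
   the loss [c = 1] below. *)
pose U' i := if i == k then nbr w :&: U k else U i :\: nbr w :\ w.
have U'U i : U' i \subset U i.
  by rewrite /U'; case: eqP => [->|_]; rewrite ?subsetIr // setDDl subsetDl.
have wv i : (i < r)%N -> w != v i /\ ~~ adj (v i) w.
  by move=> ir; apply: (st2 i k) => //; rewrite eq_sym ltk.
exists v', U'; split.
- split=> i; first exact: subset_trans (U'U i) (UV i).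
  apply: theta_shrink (Ubig i) _; rewrite /U'; case: eqP => [->//|/eqP ik].
  apply: (card_setD_ge (c := 1%N) UL) => //; rewrite lerBlDr.
  apply: le_trans (wk i ik) _; rewrite -natrD ler_nat.
  by rewrite (cardsD1 w) addnC leq_add2l leq_b1.
- move=> i x; rewrite ltS /v' /U'; case: eqP => [->|ik] /=.
    by rewrite !inE => _ /andP[].
  by move=> ir; rewrite !inE => /and3P[_ _ xU]; apply: st1.
- move=> i j x; rewrite ltS => /orP[/eqP->|ir] ji.
    by rewrite /U' /v' (negPf ji) eqxx !inE => /and3P[].
  move=> /(subsetP (U'U j)) xU; rewrite /v' ltk //; exact: st2 xU.
- move=> i j; rewrite !ltS /v' => /orP[/eqP->|ir] /orP[/eqP->|jr]; rewrite ?eqxx ?ltk //.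
  + by move=> _; have [] := wv j jr; rewrite adj_sym.
  + by move=> _; have [] := wv i ir; rewrite eq_sym.
  + exact: st3.
Qed.

Let E := oedge (complete_graph h).
(** The boolean also names the two side-vertices of [e]: [y e t] below lies next to the
    branch-vertex of [oedge_end e t]. *)
Definition oedge_end (e : E) (t : bool) : 'I_h :=
  if t then (val e).2 else (val e).1.

Lemma oedge_end_neq e : oedge_end e false != oedge_end e true.
Proof. by have /andP[] := valP e. Qed.

Lemma not_share_endpoint e f t : ~~ share_endpoint e f ->
  oedge_end e t != oedge_end f false /\ oedge_end e t != oedge_end f true.
Proof.
move=> ns; have: oedge_end e t \notin [:: (val f).1; (val f).2].
  apply: contra ns => et; apply/existsP; exists (oedge_end e t); rewrite et andbT.
  by rewrite /oedge_end; case: t {et}; rewrite !inE eqxx ?orbT.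
by rewrite !inE negb_or => /andP[].
Qed.

Lemma share_endpointC (e f : E) : share_endpoint e f = share_endpoint f e.
Proof. by apply: eq_existsb => x; rewrite andbC. Qed.

(** Edges are treated one by one, each receiving a connecting edge between the current sets at its
    two ends. Deleting neighborhoods from the sets at all other indices keeps side-vertices of
    disjoint edges of [complete_graph h] non-adjacent. *)
Lemma side_vertices_exist (N : 'I_h -> {set G}) r (s : seq E) :
  (r + size s <= Q)%N -> uniq s -> (forall i, N i \subset V i) ->
  (forall i, theta ^+ r * #|V i|%:R <= #|N i|%:R) ->
  exists (y : E -> bool -> G) U,
  [/\ (forall i, U i \subset N i) /\
      (forall i, theta ^+ (r + size s) * #|V i|%:R <= #|U i|%:R),
      forall e, e \in s -> adj (y e false) (y e true) /\
        forall t, y e t \in N (oedge_end e t),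
      forall e t k x, e \in s -> x \in U k -> x != y e t /\
        (k != oedge_end e false -> k != oedge_end e true -> ~~ adj (y e t) x)
    & forall e f t u, e \in s -> f \in s -> e != f ->
        y e t != y f u /\ (~~ share_endpoint e f -> ~~ adj (y e t) (y f u))].
Proof.
move=> + + NV Nbig; elim: s => [_ _|e s IH].
  exists (fun _ _ => x0), N; split=> //; split=> // i; by rewrite addn0.
rewrite [size _]/= addnS => rQ /andP[es us].
have [y [U [[UN Ubig] st1 st2 st3]]] := IH (ltnW rQ) us.
have UV i : U i \subset V i by apply: subset_trans (UN i) (NV i).
have UL := large_subtuple_theta (ltnW rQ) UV Ubig.
have [a [b [aU bU ab abk]]] := connecting_edge UL (oedge_end_neq e).
pose z t := if t then b else a.
have zU t : z t \in U (oedge_end e t) by case: t.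
pose y' f := if f == e then z else y f.
have y's f : f \in s -> y' f = y f.
  by move=> fs; rewrite /y'; case: eqP => // fe; move: es; rewrite -fe fs.
have y'e : y' e = z by rewrite /y' eqxx.
(* The sets at the two ends keep the neighbors of [a] and [b]: adjacencies arising there involve
   edges sharing an endpoint, hence are addable. *)
pose B k := if (k != oedge_end e false) && (k != oedge_end e true)
  then nbr a :|: nbr b else set0.
pose U' k := U k :\: B k :\: [set a; b].
have U'U k : U' k \subset U k by rewrite /U' setDDl subsetDl.
exists y', U'; split.
- split=> k; first exact: subset_trans (U'U k) (UN k).
  apply: theta_shrink (Ubig k) _.
  apply: (card_setD_ge (c := 2%N) UL) => //.
  have hB : eps * #|U k|%:R <= #|U k :\: B k|%:R.
    rewrite /B; case: ifP => [/andP[? ?]|_]; first exact: abk.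
    by rewrite setD0 ler_piMl.
  rewrite lerBlDr; apply: le_trans hB _; rewrite -natrD ler_nat.
  rewrite -(cardsID [set a; b] (U k :\: B k)) addnC leq_add2l.
  apply: leq_trans (subset_leq_card (subsetIr _ _)) _.
  by rewrite cards2; case: eqP.
- move=> f; rewrite inE => /orP[/eqP->|fs]; last by rewrite y's //; exact: st1.
  by rewrite y'e; split=> // t; apply: (subsetP (UN _)).
- move=> f t k x; rewrite inE => /orP[/eqP->|fs]; last first.
    by rewrite y's // => /(subsetP (U'U k)); apply: st2.
  rewrite y'e /U' /B !inE negb_or => /andP[/andP[xa xb] /andP[xB _]].
  split; first by case: t.
  move=> k1 k2; move: xB; rewrite k1 k2 !inE negb_or => /andP[? ?].
  by case: t.
- have new f t u : f \in s ->
      z t != y f u /\ (~~ share_endpoint e f -> ~~ adj (y f u) (z t)).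
    move=> fs; have [h1 h2] := st2 f u _ _ fs (zU t).
    by split=> // /(not_share_endpoint t)[]; apply: h2.
  move=> f g t u; rewrite !inE => /orP[/eqP->|fs] /orP[/eqP->|gs].
  + by rewrite eqxx.
  + move=> _; rewrite y'e y's //; have [? ns] := new g t u gs; split=> //.
    by rewrite adj_sym.
  + move=> _; rewrite y'e y's //; have [? ns] := new f u t fs.
    by rewrite eq_sym share_endpointC.
  + by rewrite !y's //; apply: st3.
Qed.

Lemma weak_subdivision_complete : (h + #|E| <= Q)%N ->
  contains_weak_subdivision G (complete_graph h).
Proof.
move=> hQ; have hQ' := leq_trans (leq_addr _ _) hQ.
have [v [N [[NV Nbig] vN vNn vv]]] := branch_state_exists (leqnn h) hQ'.
have [|y [U [_ yN _ yy]]] :=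
  side_vertices_exist (s := enum E) _ (enum_uniq _) NV Nbig.
  by rewrite -cardE.
(* Side-vertex 0 is next to [(val e).1] and side-vertex 1 next to [(val e).2], which matches the
   boolean of [oedge_end]. *)
pose k (e : E) := 2%N.
pose g (u : subdivision k) : G :=
  match u with inl i => v i | inr s => y (tag s) (tagged s == 1%N :> nat) end.
have {}vN i x : x \in N i -> adj (v i) x by apply: vN.
have {}vNn i j x : j != i -> x \in N j -> x != v i /\ ~~ adj (v i) x.
  by apply: vNn.
have {}vv i j : i != j -> v i != v j /\ ~~ adj (v i) (v j) by apply: vv.
have ye e : adj (y e false) (y e true) by case: (yN e); rewrite ?mem_enum.
have {}yN e t : y e t \in N (oedge_end e t).
  by have [|_] := yN e; rewrite ?mem_enum.
have {}yy e f t u : e != f -> y e t != y f u /\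
    (~~ share_endpoint e f -> ~~ adj (y e t) (y f u)).
  by apply: yy; rewrite mem_enum.
have vy i e t : v i != y e t.
  have [eE|ei] := eqVneq (oedge_end e t) i.
    by apply/eqP => vye; have := vN _ _ (yN e t); rewrite eE vye adj_irr.
  by rewrite eq_sym; case: (vNn _ _ _ ei (yN e t)).
have vyadj i e t : adj (v i) (y e t) = (i == oedge_end e t).
  have [->|ei] := eqVneq i (oedge_end e t); first by rewrite vN.
  by apply/negbTE; rewrite eq_sym in ei; case: (vNn _ _ _ ei (yN e t)).
apply: (@contains_weak_subdivision_embedding _ _ k g) => //.
- move=> [i|[e p]] [j|[f q]] /=.
  + by have [->//|/vv[/negP ne _]] := eqVneq i j => /eqP.
  + by move=> /eqP; rewrite (negPf (vy _ _ _)).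
  + by move=> /eqP; rewrite eq_sym (negPf (vy _ _ _)).
  + have [->|/yy ne /eqP] := eqVneq e f; last first.
      by rewrite (negPf (ne _ _).1).
    have ab : y f false != y f true.
      by apply/eqP => yE; have := ye f; rewrite yE adj_irr.
    case: p q => -[|[|//]] ? [[|[|//]] ?] /=; try by move=> _;
      congr (inr (existT _ _ _)); apply: val_inj.
    * by move/eqP; rewrite (negPf ab).
    * by move/eqP; rewrite eq_sym (negPf ab).
- have step u w : subdiv_step u w -> adj (g u) (g w).
    case: u w => [i|[e p]] [j|[f q]] //=.
    + by case/andP => /eqP-> /eqP->; rewrite vyadj.
    + by case/andP => /eqP[p1] /eqP->; rewrite adj_sym vyadj p1 eqxx.
    + case/andP => /eqP ef; subst f.
      by case: p q => -[|[|//]] ? [[|[|//]] ?].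
  by move=> u w /orP[/step//|/step]; rewrite adj_sym.
- have vyE i e (p : 'I_2) : adj (v i) (y e (p == 1%N :> nat)) ->
      subdiv_adj (k := k) (inl i) (inr (existT _ e p)).
    rewrite vyadj => /eqP ->; rewrite /subdiv_adj /=.
    by case: p => -[|[|//]] ?; rewrite /= eqxx ?orbT.
  move=> [i|[e p]] [j|[f q]] /=.
  + by have [->|/vv[_ /negP//]] := eqVneq i j; rewrite adj_irr.
  + by move=> /vyE; left.
  + by rewrite adj_sym => /vyE iE; left; rewrite subdiv_adj_sym.
  have [->|ef] := eqVneq e f; last first.
    have [_ _|ns] := boolP (share_endpoint e f); first by right.
    by rewrite (negPf ((yy e f _ _ ef).2 ns)).
  case: p q => -[|[|//]] ? [[|[|//]] ?] /=; rewrite ?adj_irr // => _; left.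
  + by rewrite /subdiv_adj /= eqxx.
  + by rewrite /subdiv_adj /= eqxx orbT.
Qed.

End Embedding.

(** * Consequences of the hypotheses and choice of the constants *)

Lemma graph_full_order_gt (R : realType) (delta : R) (G : sgraph) :
  delta <= 1 -> graph_full delta G ->
  inhabited G /\ 1 < delta * (graph_order G)%:R.
Proof.
move=> d1 full; have dT : delta * (graph_order G)%:R <= #|[set: G]|%:R.
  by rewrite cardsT ler_piMl.
have [x _] := full _ _ dT dT; split; first exact: (inhabits x).
rewrite ltNge; apply/negP => le1.
have [||a [b []]] := full [set x] [set x]; rewrite ?cards1 //.
by rewrite !inE => /eqP-> /eqP->; rewrite adj_irr.
Qed.

Lemma graph_dense_ecount (R : realType) (alpha beta : R) (G : sgraph)
    (A : {set G}) : graph_dense alpha beta G -> (0 < #|A|)%N ->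
  alpha * (graph_order G)%:R <= #|A|%:R ->
  beta * #|A|%:R ^+ 2 <= (ecount A A)%:R.
Proof.
move=> dense A0 /dense; rewrite /graph_density /graph_order card_sig.
rewrite (_ : #|[pred x | x \in A]| = #|A|); last exact: eq_card.
rewrite ler_pdivlMr ?exprn_gt0 ?ltr0n // => /le_trans; apply.
by rewrite ler_nat edges_induced_le.
Qed.

Theorem theorem6 (R : realType) (C : R) (C_gt0 : 0 < C)
  (C_string : forall (n : nat) (G : sgraph), (2 <= n)%N -> graph_order G = n ->
     string_graph R G -> #|edges G|%:R <= C * n%:R ^+ 2 ->
     exists A B : {set complement G},
       biclique A B /\ n%:R / 4%:R <= #|A|%:R :> R) :
  forall eps : R, 0 < eps -> exists delta : R, 0 < delta < 2%:R^-1 /\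
    forall (n : nat) (G : sgraph), graph_order G = n ->
      #|edges G|%:R <= (4%:R^-1 - eps) * (n%:R ^+ 2 / 2%:R) ->
      graph_dense (4%:R * delta) C G -> graph_full delta G ->
      contains_weak_subdivision G (complete_graph 5).
Proof.
move=> eps eps_gt0; pose e := Num.min eps 8^-1.
have e0 : 0 < e by rewrite lt_min eps_gt0 invr_gt0 ltr0n.
have [ele e8] : e <= eps /\ e <= 8^-1 by split; rewrite ge_min lexx ?orbT.
pose th : R := Num.min C e / 2.
(* One shrinking step for each branch-vertex and each edge of the complete graph. *)
have [Q QE] : exists Q, (5 + #|oedge (complete_graph 5)| <= Q)%N.
  by eexists.
have th0 : 0 < th by rewrite divr_gt0 ?ltr0n // lt_min C_gt0.
have [thC the] : 2 * th <= C /\ 2 * th <= e.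
  by split; rewrite /th mulrC divfK ?pnatr_eq0 // ge_min lexx ?orbT.
have thQ0 : 0 < th ^+ Q by rewrite exprn_gt0.
have thQ1 : th ^+ Q <= 1 by rewrite exprn_ile1 ?ltW //; lra.
(* [V_big] needs [12 * m i <= th ^+ Q * #|V i|], and [m i <= 3 * kap * #|V i|]; hence 36. *)
pose kap := th ^+ Q / 36.
have kap0 : 0 < kap by rewrite divr_gt0 ?ltr0n.
have kap2 : kap <= 2^-1 by rewrite /kap; lra.
have ek0 : 0 < e * kap ^+ 5 by rewrite mulr_gt0 ?exprn_gt0.
have [K hK] : exists K, 5%:R ^+ 2 < e * kap ^+ 5 * K%:R.
  exists (Num.bound (5%:R ^+ 2 / (e * kap ^+ 5))).
  by rewrite mulrC -ltr_pdivrMr // archi_boundP // divr_ge0 ?exprn_ge0 // ltW.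
pose p := kap ^+ K.+1; have p0 : 0 < p by rewrite exprn_gt0.
have p1 : p <= 1 by rewrite exprn_ile1 ?ltW //; lra.
(* With [m i >= p * (e / 2) * n], this makes [e * m i >= 4 * delta * n], which exceeds 4 because
   fullness forces [delta * n > 1]. *)
pose delta := p * e ^+ 2 / 8.
have d0 : 0 < delta by rewrite divr_gt0 ?mulr_gt0 ?exprn_gt0 ?ltr0n.
have ee : e ^+ 2 <= e by rewrite expr2 ler_piMl ?ltW //; lra.
have de : 8 * delta <= p * e.
  by rewrite /delta mulrC divfK ?pnatr_eq0 // ler_pM2l.
have pe1 : p * e <= 8^-1 by apply: le_trans e8; rewrite ler_piMl // ltW.
exists delta; split; first by rewrite d0; lra.
move=> n G <- {n} hE dense full; set n : R := (graph_order G)%:R.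
have [|[x0] dn1] := graph_full_order_gt _ full; first by lra.
have n0 : 0 <= n by exact: ler0n.
(* The margin [e] is split: one half makes [W] large, the other remains in the degree bound. *)
have [||| W [Wbig Wdeg]] := @low_degree_core R G (4^-1 - e / 2) (e / 2).
- by lra.
- by apply/andP; split; lra.
- have := ecount_setT_le G; rewrite -(ler_nat R) natrM => /le_trans; apply.
  have : e * n ^+ 2 <= eps * n ^+ 2 by rewrite ler_wpM2r // sqr_ge0.
  by move: hE; rewrite -/n; lra.
have pW : p * (e / 2 * n) <= p * #|W|%:R by rewrite ler_pM2l.
have hd : delta * n * 8 <= p * e * n.
  by rewrite mulrAC ler_wpM2r // mulrC.
have pK : p * #|W|%:R <= kap ^+ K * #|W|%:R.
  by rewrite ler_wpM2r // /p exprS ler_piMl ?exprn_ge0 ?ltW //; lra.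
have [||||V [m [mbig mV star_le]]] :=
  @hereditary_tuple R G 5 W (4^-1 - e / 2) e kap K Wdeg.
- exact: ltW.
- by rewrite kap0.
- exact: hK.
- by move: dn1; rewrite -/n; lra.
have mdn i : 4 * (delta * n) <= m i by apply: le_trans (mbig i); rewrite -/p; lra.
have me i : 4 <= e * m i.
  have : e * (p * (e / 2 * n)) <= e * m i.
    by rewrite ler_pM2l // (le_trans pW).
  have : e * (p * (e / 2 * n)) = 4 * (delta * n) by rewrite /delta; field.
  by move: dn1; rewrite -/n; lra.
apply: (@weak_subdivision_complete R G 5 x0 V m e C th Q) => //.
- by lra.
- by lra.
- move=> i; have := mV i; rewrite /kap; lra.
- move=> i j A B Am Bm; apply: full; rewrite -/n.
    by have := mdn i; move: dn1; rewrite -/n; lra.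
  by have := mdn j; move: dn1; rewrite -/n; lra.
- move=> i A Am; apply: (graph_dense_ecount dense).
    rewrite -(ltr0n R) (lt_le_trans _ Am) //.
    by have := mdn i; move: dn1; rewrite -/n; lra.
  by rewrite -/n -mulrA (le_trans (mdn i)).
(* Four densities suffice for the arithmetic: [4 * (1/4 - e/2) + e = 1 - e]. *)
- by move=> U hU k; apply: le_trans (star_le U hU k) _; rewrite /=; lra.
Qed.
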